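(* Let $\mathcal{X}$ be a nonempty open subset of a Euclidean space and let $f:\mathcal{X}\to\mathbb{R}$ be real analytic, bounded below and proper. Suppose that the gradient $\nabla f$ is globally bounded on $\mathcal{X}$ and that $f$ satisfies a class-$\mathcal{K}_{\mathrm{SAT}}$ lower bound. Then the gradient flow $\dot x=-\nabla f(x)$ is globally linear-exponentially stable (GLES).
   Context: Let $\underline f=\inf_{x\in\mathcal{X}}f(x)$, and let $\phi(t,x_0)$, $t\ge 0$, denote the solution of $\dot x=-\nabla f(x)$ with $\phi(0,x_0)=x_0$. A function $f$ bounded below is proper if all its sublevel sets are compact subsets of $\mathcal{X}$ (preimages of compact sets are compact). $f$ satisfies a class-$\mathcal{K}_{\mathrm{SAT}}$ lower bound if there are constants $a,b>0$ such that $\|\nabla f(x)\|\ge\alpha(f(x)-\underline f)$ for all $x\in\mathcal{X}$, where $\alpha(r)=\sqrt{\frac{ar}{b+r}}$ for $r\ge0$. The gradient flow is GLES if there exists $m>0$ such that for every $x_0\in\mathcal{X}$ and every $\underline t>0$ there exists $\mu_{x_0,\underline t}>0$ such that, for all $t\ge 0$, $$f(\phi(t,x_0))-\underline f\le\begin{cases}\big(f(\phi(\underline t,x_0))-\underline f\big)-m(t-\underline t) & \text{if } t\le\underline t,\\ \big(f(\phi(\underline t,x_0))-\underline f\big)\,e^{-\mu_{x_0,\underline t}(t-\underline t)} & \text{if } t>\underline t.\end{cases}$$ *)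

(* Defs.v *)
From mathcomp Require Import all_boot all_order all_algebra.
From mathcomp Require Import all_classical all_reals all_analysis summability.

Set Implicit Arguments.
Unset Strict Implicit.
Unset Printing Implicit Defensive.

Import Order.TTheory GRing.Theory Num.Theory.
Import numFieldNormedType.Exports.

Local Open Scope classical_set_scope.
Local Open Scope ring_scope.

(* The Euclidean space R^n is ['rV[R]_n]; its library norm
   is the sup norm, which induces the same topology but is not the norm in
   which gradients are measured, hence [enorm]. A function f : X -> R is
   represented by a total function of which only the values on the open set X
   are ever used. *)

Section gradient_systems.
Variables (R : realType) (n : nat).
Implicit Types (X : set 'rV[R]_n) (f : 'rV[R]_n -> R).

Definition enorm (v : 'rV[R]_n) : R := Num.sqrt (\sum_i v 0 i ^+ 2).

Definition grad f (x : 'rV[R]_n) : 'rV[R]_n := \row_i 'D_(delta_mx 0 i) f x.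

(* Multi-indices are finite functions 'I_n -> nat. A multiple power series has
   no preferred order of summation: its convergence is along the net of finite
   sets of multi-indices. *)
Definition power_series_sums_to (c : {ffun 'I_n -> nat} -> R)
    (h : 'rV[R]_n) (s : R) : Prop :=
  partial_sum (fun k => c k * \prod_i h 0 i ^+ k i) @ totally --> s.

Definition real_analytic_on X f : Prop :=
  forall x, X x ->
  exists c : {ffun 'I_n -> nat} -> R,
  \forall y \near x, power_series_sums_to c (y - x) (f y).

Definition proper_on X f : Prop :=
  forall c : R, compact [set x | X x /\ f x <= c].

Definition finf X f : R := inf (f @` X).

Definition bounded_gradient X f : Prop :=
  exists L : R, forall x, X x -> enorm (grad f x) <= L.

Definition alpha_sat (a b r : R) : R := Num.sqrt (a * r / (b + r)).

Definition KSAT_lower_bound X f : Prop :=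
  exists a b : R, [/\ 0 < a, 0 < b &
    forall x, X x -> alpha_sat a b (f x - finf X f) <= enorm (grad f x)].

(* phi t x0 is the value at time t of the solution issued from x0; phi is
   unconstrained for t < 0, so the derivative at t = 0 is the right one. *)
Definition gradient_flow X f (phi : R -> 'rV[R]_n -> 'rV[R]_n) : Prop :=
  forall x0, X x0 ->
  [/\ phi 0 x0 = x0,
      forall t : R, 0 <= t -> X (phi t x0),
      h^-1 *: (phi h x0 - phi 0 x0) @[h --> 0^'+] --> - grad f (phi 0 x0) &
      forall t : R, 0 < t ->
        is_derive t 1 (phi^~ x0) (- grad f (phi t x0))].

Definition GLES_along X f (phi : R -> 'rV[R]_n -> 'rV[R]_n) : Prop :=
  exists2 m : R, 0 < m &
  forall x0, X x0 -> forall tbar : R, 0 < tbar ->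
  exists2 mu : R, 0 < mu &
  forall t : R, 0 <= t ->
    f (phi t x0) - finf X f <=
      if t <= tbar
      then (f (phi tbar x0) - finf X f) - m * (t - tbar)
      else (f (phi tbar x0) - finf X f) * expR (- mu * (t - tbar)).

(* The estimate is only meaningful once the flow exists for all t >= 0; this
   is part of the property, so that it never holds vacuously. *)
Definition GLES X f : Prop :=
  (exists phi, gradient_flow X f phi) /\
  (forall phi, gradient_flow X f phi -> GLES_along X f phi).

End gradient_systems.

(* Main.v *)
Require Import Defs.
From mathcomp Require Import all_boot all_order all_algebra finmap.
From mathcomp Require Import all_classical all_reals all_analysis.
From mathcomp Require Import summability ring lra.

(** Write V(t) for f(phi(t)) - inf f along a trajectory. By the chain rule
    V' = - |grad f|^2. A bound L on the gradient gives V' >= - L^2, so V is at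
    most its value at tbar plus L^2 (tbar - t) before tbar, which is the linear
    phase. After tbar, V is at most V(tbar), and the lower bound on the gradient
    gives V' <= - a V / (b + V) <= - a / (b + V(tbar)) V, so V decays
    exponentially ([le_expR_decay]).

    What this uses about analyticity is one estimate, proved from the power
    series: near each point of X, f(v) - f(u) and <grad f u, v - u> differ by at
    most C |v - u|^2 with C independent of u and v ([analytic_quad_error_grad]).
    It makes the chain rule available and it makes the gradient locally
    Lipschitz. To prove it, fix u and attach to a function p on a box three
    constants: a bound a0 of p, a Lipschitz and gradient bound a1, and a bound a2
    of the quadratic Taylor remainder at u. The weight a0 + a1 s + a2 s^2 is
    subadditive and submultiplicative, and it is at most r + s for a coordinate
    on the box of radius r. The weights of the partial sums of the power series
    are therefore at most those of the absolute sums at the corner (r + s, ...,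
    r + s), which are bounded because unconditional convergence in R is absolute
    ([cvg_partial_sum_norm_bounded]). The remainder bound passes to the limit,
    the linear parts converging along an ultrafilter by compactness.

    Existence of the flow goes through Euler polygons on the compact sublevel
    set K of f(x0). For small steps the quadratic estimate makes f decrease
    along the scheme, so the polygons stay in K, where the gradient is bounded
    and Lipschitz. With F = - grad f and y the step function running through the
    vertices, y(t + h) - y(t) - h F(y(t)) is therefore O((h + step)^2 + step)
    uniformly in t. The values y(t) have limits in K along an ultrafilter of
    steps, by compactness. In the limit the error becomes O(h^2), so that the
    limit is a solution for all t >= 0, inside K ([euler_limit]). *)

Set Implicit Arguments.
Unset Strict Implicit.
Unset Printing Implicit Defensive.

Import Order.TTheory GRing.Theory Num.Theory.
Import numFieldNormedType.Exports.

Local Open Scope classical_set_scope.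
Local Open Scope ring_scope.

(** * Unconditional convergence of real families *)

#[local] Existing Instance totally_filter.

Lemma partial_sum_seq (I : choiceType) (R : zmodType) (x : I -> R)
  (A : {fset I}) : partial_sum x A = \sum_(i <- A) x i.
Proof. by rewrite /partial_sum big_seq_fsetE. Qed.

(** Beyond some finite set A0, all finite partial sums are small; applied
    separately to the nonnegative and to the negative terms, this bounds the sum
    of the absolute values outside A0. *)
Lemma cvg_partial_sum_norm_bounded (R : realType) (I : choiceType) (x : I -> R)
    (s : R) : partial_sum x @ totally --> s ->
  (exists M : R, forall A : {fset I}, \sum_(i <- A) `|x i| <= M)%R.
Proof.
move=> /cvgrPdist_lt /(_ 1 ltr01) [A0 _ sA0].
have tail B : [disjoint B & A0]%fset -> `|\sum_(i <- B) x i| < 2.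
  move=> dBA; have := sA0 A0 (fsubset_refl _).
  have := sA0 (A0 `|` B)%fset (fsubsetUl _ _).
  rewrite /= !partial_sum_seq.
  have -> : \sum_(i <- (A0 `|` B)%fset) x i =
      \sum_(i <- A0) x i + \sum_(i <- B) x i.
    rewrite (big_fsetID _ (mem A0)) /=.
    by congr (_ + _); apply: eq_fbigl => i; rewrite !inE /=;
      have := fdisjointP dBA i; case: (i \in B); case: (i \in A0) => // /(_ isT).
  set S0 := \sum_(i <- A0) x i; set SB := \sum_(i <- B) x i.
  rewrite !ltr_norml => /andP[? ?] /andP[? ?]; apply/andP; split; lra.
exists (\sum_(i <- A0) `|x i| + 4) => A.
rewrite (big_fsetID _ (mem A0)) /=; apply: lerD.
  have -> : [fset i in A | i \in A0]%fset = [fset i in A0 | i \in A]%fset.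
    by apply/fsetP => i; rewrite !inE /= andbC.
  by rewrite [leRHS](big_fsetID _ (mem A)) /= lerDl; apply: sumr_ge0.
set T := [fset _ in A | _]%fset.
have dT B : (B `<=` T)%fset -> [disjoint B & A0]%fset.
  move=> /fsubsetP BT; apply/fdisjointP => i /BT; rewrite !inE /=.
  by move=> /andP[].
rewrite (big_fsetID _ (fun i => 0 <= x i)) /=.
have -> : (4 : R) = 2 + 2 by lra.
apply: lerD.
  rewrite [leLHS](_ : _ = \sum_(i <- [fset i in T | 0%R <= x i]%fset) x i).
    apply: le_trans (ler_norm _) (ltW (tail _ (dT _ _))).
    by apply/fsubsetP => i; rewrite !inE /= => /andP[].
  by apply: eq_big_seq => i; rewrite !inE /= => /andP[_ /ger0_norm].
rewrite [leLHS](_ : _ = - \sum_(i <- [fset i in T | ~~ (0%R <= x i)]%fset) x i).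
  apply: le_trans (ler_norm _) _; rewrite normrN; apply/ltW/tail/dT.
  by apply/fsubsetP => i; rewrite !inE /= => /andP[].
rewrite -sumrN; apply: eq_big_seq => i; rewrite !inE /= -ltNge => /andP[_].
by move=> /ltr0_norm.
Qed.

(** * Limits along ultrafilters *)

Lemma fmap_ultra (S T : Type) (h : S -> T) (U : set_system S) :
  UltraFilter U -> UltraFilter (h @ U).
Proof.
move=> UU; split=> [|G GP hUG]; first exact: fmap_proper_filter.
apply/seteqP; split=> // A GA; rewrite /fmap /=.
have [//|UnA] := in_ultra_setVsetC (h @^-1` A) UU.
have /hUG GnA : (h @ U) (~` A) by [].
by have /filter_ex[y []] : G (A `&` ~` A) by exact: filterI.
Qed.

Lemma compact_ultra_cvg (S : Type) (T : topologicalType) (h : S -> T)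
    (U : set_system S) (K : set T) : UltraFilter U -> compact K ->
  (\forall t \near U, K (h t)) -> exists2 l, K l & h t @[t --> U] --> l.
Proof.
rewrite compact_ultra => UU Kco UK.
by have [l [Kl hl]] := Kco _ (fmap_ultra h UU) UK; exists l.
Qed.

(** * The Euclidean inner product *)

Section dot.
Context {R : realType} {n : nat}.
Implicit Types u v w D : 'rV[R]_n.

Lemma coord_le_norm v i : `|v 0 i| <= `|v|.
Proof.
rewrite [leRHS]/Num.norm /= mx_normrE.
by apply: (le_trans _ (le_bigmax _ _ (0, i))).
Qed.

Lemma norm_le_coord v (c : R) : 0 <= c -> (forall i, `|v 0 i| <= c) -> `|v| <= c.
Proof.
move=> c0 vc; rewrite [leLHS]/Num.norm /= mx_normrE.
by apply: bigmax_le => // -[i j] _ /=; rewrite ord1.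
Qed.

Definition dot u v : R := \sum_i u 0 i * v 0 i.

Lemma dotDl u v w : dot (u + v) w = dot u w + dot v w.
Proof. by rewrite -big_split; apply: eq_bigr => i _; rewrite mxE mulrDl. Qed.

Lemma dotDr u v w : dot w (u + v) = dot w u + dot w v.
Proof. by rewrite -big_split; apply: eq_bigr => i _; rewrite mxE mulrDr. Qed.

Lemma dotZl a u v : dot (a *: u) v = a * dot u v.
Proof. by rewrite mulr_sumr; apply: eq_bigr => i _; rewrite mxE mulrA. Qed.

Lemma dotZr a u v : dot u (a *: v) = a * dot u v.
Proof. by rewrite mulr_sumr; apply: eq_bigr => i _; rewrite mxE mulrCA. Qed.

Lemma dotNr u v : dot u (- v) = - dot u v.
Proof. by rewrite -scaleN1r dotZr mulN1r. Qed.

Lemma dot_delta u i : dot u (delta_mx 0 i) = u 0 i.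
Proof.
rewrite /dot (bigD1 i) //= mxE !eqxx mulr1 big1 ?addr0 // => j ji.
by rewrite mxE (negPf ji) andbF mulr0.
Qed.

Lemma delta_dot u i : dot (delta_mx 0 i) u = u 0 i.
Proof.
by rewrite -[RHS]dot_delta; apply: eq_bigr => j _; rewrite mulrC.
Qed.

Lemma cvg_dot {T} (F : set_system T) {FF : Filter F} (f g : T -> 'rV[R]_n) u v :
  f x @[x --> F] --> u -> g x @[x --> F] --> v ->
  dot (f x) (g x) @[x --> F] --> dot u v.
Proof.
move=> fu gv; have crd (h : T -> 'rV[R]_n) w (i : 'I_n) :
    h x @[x --> F] --> w -> h x 0 i @[x --> F] --> w 0 i.
  by move=> hw; apply: (cvg_comp _ (fun M => M 0 i) hw); exact: coord_continuous.
rewrite /dot; apply: cvg_big => [|i _]; first exact: add_continuous.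
by apply: cvgM; apply: crd.
Qed.

End dot.

(** * A submultiplicative weight controlling Taylor remainders *)

Section taylor.
Context {R : realType} {n : nat}.
Variables (B : set 'rV[R]_n) (u : 'rV[R]_n) (s : R).
Hypotheses (Bu : B u) (s0 : 0 < s).
Implicit Types (p q : 'rV[R]_n -> R) (N : R).

(** The weight a0 + a1 s + a2 s^2 is the norm of a truncated polynomial algebra:
    multiplying functions multiplies the triples (a0, a1, a2) modulo s^3. A bound
    N on the weight bounds a1 by N / s and a2 by N / s^2. *)
Definition taylor_le p N := exists D : 'rV[R]_n, exists a0 a1 a2 : R,
  [/\ [/\ 0 <= a0, 0 <= a1 & 0 <= a2],
      a0 + a1 * s + a2 * s ^+ 2 <= N,
      forall i, `|D 0 i| <= a1
    & forall v, B v ->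
      [/\ `|p v| <= a0, `|p v - p u| <= a1 * `|v - u|
        & `|p v - p u - dot D (v - u)| <= a2 * `|v - u| ^+ 2]].

Lemma taylor_le_cst c : taylor_le (fun=> c) `|c|.
Proof.
exists 0, `|c|, 0, 0; split => //.
- by rewrite !mul0r !addr0.
- by move=> i; rewrite mxE normr0.
move=> v Bv; split => //; rewrite !mul0r ?subrr ?normr0//.
by rewrite sub0r /dot big1 ?oppr0 ?normr0// => i _; rewrite mxE mul0r.
Qed.

Lemma taylor_le_coord (x : 'rV[R]_n) (r : R) i :
  (forall v, B v -> `|v - x| <= r) ->
  taylor_le (fun v => (v - x) 0 i) (r + s).
Proof.
move=> Br; have r0 : 0 <= r by apply: le_trans (Br _ Bu).
exists (delta_mx 0 i), r, 1, 0; split => //.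
- by rewrite mul1r mul0r addr0.
- by move=> j; rewrite mxE; case: (_ && _); rewrite ?normr1 ?normr0.
move=> v Bv.
have e : (v - x) 0 i - (u - x) 0 i = (v - u) 0 i by rewrite !mxE; ring.
split; first exact: le_trans (coord_le_norm _ _) (Br _ Bv).
  by rewrite e mul1r coord_le_norm.
by rewrite e delta_dot subrr normr0 mul0r.
Qed.

Lemma taylor_leW p N N' : N <= N' -> taylor_le p N -> taylor_le p N'.
Proof.
move=> NN' [D [a0 [a1 [a2 [a aN Da pa]]]]]; exists D, a0, a1, a2.
by split=> //; apply: le_trans NN'.
Qed.

Lemma taylor_leD p q N M : taylor_le p N -> taylor_le q M ->
  taylor_le (fun v => p v + q v) (N + M).
Proof.
move=> [D [a0 [a1 [a2 [[a00 a10 a20] aN Da pa]]]]].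
move=> [E [b0 [b1 [b2 [[b00 b10 b20] bM Eb qb]]]]].
exists (D + E), (a0 + b0), (a1 + b1), (a2 + b2); split.
- by split; apply: addr_ge0.
- by apply: le_trans (lerD aN bM); rewrite le_eqVlt; apply/predU1P; left; ring.
- by move=> i; rewrite mxE; apply: le_trans (ler_normD _ _) (lerD _ _).
move=> v Bv; have [p0 p1 p2] := pa v Bv; have [q0 q1 q2] := qb v Bv.
split; first exact: le_trans (ler_normD _ _) (lerD _ _).
  rewrite mulrDl (_ : _ - _ = (p v - p u) + (q v - q u)); last by ring.
  exact: le_trans (ler_normD _ _) (lerD _ _).
rewrite dotDl mulrDl (_ : _ - _ = (p v - p u - dot D (v - u)) +
  (q v - q u - dot E (v - u))); last by ring.
exact: le_trans (ler_normD _ _) (lerD _ _).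
Qed.

Lemma taylor_leM p q N M : taylor_le p N -> taylor_le q M ->
  taylor_le (fun v => p v * q v) (N * M).
Proof.
move=> [D [a0 [a1 [a2 [[a00 a10 a20] aN Da pa]]]]].
move=> [E [b0 [b1 [b2 [[b00 b10 b20] bM Eb qb]]]]].
have [pu _ _] := pa u Bu; have [qu _ _] := qb u Bu.
exists (p u *: E + q u *: D), (a0 * b0), (a0 * b1 + b0 * a1),
  (a0 * b2 + b0 * a2 + a1 * b1); split.
- by split; rewrite ?addr_ge0 ?mulr_ge0.
- have s0' := ltW s0.
  apply: (@le_trans _ _ ((a0 + a1 * s + a2 * s ^+ 2) *
                         (b0 + b1 * s + b2 * s ^+ 2))); last first.
    by apply: ler_pM => //; rewrite ?addr_ge0 ?mulr_ge0 ?exprn_ge0.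
  (* the terms dropped by the product modulo s ^ 3 are nonnegative *)
  rewrite -subr_ge0 (_ : _ - _ = (a1 * b2 + a2 * b1) * s ^+ 3 +
    a2 * b2 * s ^+ 4); last by ring.
  by rewrite ?addr_ge0 ?mulr_ge0 ?exprn_ge0 ?addr_ge0 ?mulr_ge0.
- move=> i; rewrite !mxE; apply: le_trans (ler_normD _ _) _.
  by rewrite !normrM; apply: lerD; apply: ler_pM.
move=> v Bv; have [p0 p1 p2] := pa v Bv; have [q0 q1 q2] := qb v Bv.
split; first by rewrite normrM; apply: ler_pM.
  rewrite (_ : _ - _ = p v * (q v - q u) + q u * (p v - p u)); last by ring.
  rewrite mulrDl -!mulrA; apply: le_trans (ler_normD _ _) _.
  by rewrite !normrM; apply: lerD; apply: ler_pM.
rewrite dotDl !dotZl (_ : _ - _ = p u * (q v - q u - dot E (v - u)) +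
  q u * (p v - p u - dot D (v - u)) + (p v - p u) * (q v - q u)); last by ring.
rewrite [leRHS]mulrDl; apply: le_trans (ler_normD _ _) _.
apply: lerD; last first.
  rewrite normrM (_ : a1 * b1 * _ = a1 * `|v - u| * (b1 * `|v - u|)); last by ring.
  exact: ler_pM.
rewrite mulrDl -!mulrA; apply: le_trans (ler_normD _ _) _.
by rewrite !normrM; apply: lerD; apply: ler_pM.
Qed.

Lemma taylor_leX p N k : taylor_le p N -> taylor_le (fun v => p v ^+ k) (N ^+ k).
Proof.
move=> pN; elim: k => [|k IH].
  by apply: taylor_leW (taylor_le_cst 1); rewrite normr1.
under eq_fun do rewrite exprS; rewrite exprS; exact: taylor_leM.
Qed.

Lemma taylor_le_prod (I : Type) (l : seq I) (p : I -> 'rV[R]_n -> R) (N : I -> R) :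
  (forall i, taylor_le (p i) (N i)) ->
  taylor_le (fun v => \prod_(i <- l) p i v) (\prod_(i <- l) N i).
Proof.
move=> pN; elim: l => [|i l IH].
  under eq_fun do rewrite big_nil; rewrite big_nil.
  by apply: taylor_leW (taylor_le_cst 1); rewrite normr1.
under eq_fun do rewrite big_cons; rewrite big_cons; exact: taylor_leM.
Qed.

Lemma taylor_le_sum (I : Type) (l : seq I) (p : I -> 'rV[R]_n -> R) (N : I -> R) :
  (forall i, taylor_le (p i) (N i)) ->
  taylor_le (fun v => \sum_(i <- l) p i v) (\sum_(i <- l) N i).
Proof.
move=> pN; elim: l => [|i l IH].
  under eq_fun do rewrite big_nil; rewrite big_nil.
  by apply: taylor_leW (taylor_le_cst 0); rewrite normr0.
under eq_fun do rewrite big_cons; rewrite big_cons; exact: taylor_leD.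
Qed.

(** The linear part of the limit is a limit point of the linear parts, whose
    coefficients are bounded by N / s; pointwise convergence of the functions is
    then enough. *)
Lemma taylor_le_lim T (F : set_system T) {FF : ProperFilter F}
    (p : T -> 'rV[R]_n -> R) (f : 'rV[R]_n -> R) N :
  (forall t, taylor_le (p t) N) ->
  (forall v, B v -> p t v @[t --> F] --> f v) ->
  exists D : 'rV[R]_n, forall v, B v ->
    `|f v - f u - dot D (v - u)| <= N / s ^+ 2 * `|v - u| ^+ 2.
Proof.
move=> pN pf.
have {pN} /choice[D HD] t : exists D : 'rV[R]_n,
    (forall i, `|D 0 i| <= N / s) /\
    forall v, B v ->
      `|p t v - p t u - dot D (v - u)| <= N / s ^+ 2 * `|v - u| ^+ 2.
  have [D [a0 [a1 [a2 [[a00 a10 a20] aN Da pa]]]]] := pN t.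
  have s0' := ltW s0; exists D; split => [i|v Bv].
    apply: le_trans (Da i) _; rewrite ler_pdivlMr//; apply: le_trans aN.
    by rewrite addrAC lerDr addr_ge0 ?mulr_ge0 ?exprn_ge0.
  have [_ _ h] := pa v Bv; apply: le_trans h _; apply: ler_wpM2r.
    exact: exprn_ge0.
  rewrite ler_pdivlMr ?exprn_gt0//; apply: le_trans aN.
  by rewrite lerDr addr_ge0 ?mulr_ge0.
have [U [UU FU]] := ultraFilterLemma FF.
have Kco : compact
    [set v : 'rV[R]_n | forall i, v ord0 i \in `[(- (N / s)), N / s]].
  apply: (@rV_compact _  _ (fun=> `[(- (N / s)), N / s]%classic)).
  by move=> _; apply: segment_compact.
have [|D0 _ UD] := compact_ultra_cvg (h := D) UU Kco.
  by apply: filterE => t i; rewrite in_itv /= -ler_norml; have [] := HD t.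
exists D0 => v Bv.
have cU w : B w -> p t w @[t --> U] --> f w.
  by move=> Bw A /(pf w Bw) /FU.
have lim : (`|p t v - p t u - dot (D t) (v - u)|) @[t --> U] -->
    `|f v - f u - dot D0 (v - u)|.
  apply: cvg_norm; apply: cvgB; first by apply: cvgB; apply: cU.
  by apply: cvg_dot => //; apply: cvg_cst.
apply: (closed_cvg (fun y => y <= N / s ^+ 2 * `|v - u| ^+ 2)) lim.
  exact: closed_le.
by apply: filterE => t; have [_] := HD t; apply.
Qed.

End taylor.

(** * First-order expansion of analytic functions *)

Section quad.
Context {R : realType} {n : nat}.
Implicit Types (X K : set 'rV[R]_n) (f : 'rV[R]_n -> R) (u v w x D : 'rV[R]_n).

Definition quad_error f D C u v :=
  `|f v - f u - dot D (v - u)| <= C * `|v - u| ^+ 2.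

(** The power series at x converges at the corner h of the box of radius e / 2;
    on the box of half that radius, with s equal to that half radius, the monomial
    of index k has weight at most its value at h. *)
Lemma analytic_quad_error X f x : real_analytic_on X f -> X x ->
  exists r C : R, [/\ 0 < r, 0 <= C & forall u, `|u - x| <= r ->
    exists D, forall v, `|v - x| <= r -> quad_error f D C u v].
Proof.
move=> fa /fa[c] /nbhs_ballP[e /= e0 ec].
have half_e : 0 < e / 2 by rewrite divr_gt0.
pose h : 'rV[R]_n := const_mx (e / 2).
have in_e v : `|v - x| <= e / 2 -> power_series_sums_to c (v - x) (f v).
  move=> vx; apply: ec; rewrite -ball_normE /ball_ /= distrC.
  by apply: le_lt_trans vx _; rewrite ltr_pdivrMr// ltr_pMr// ltr1n.
have hle : `|(x + h) - x| <= e / 2.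
  rewrite addrAC subrr add0r; apply: norm_le_coord => [|i]; first exact: ltW.
  by rewrite mxE gtr0_norm.
have [M cM] := cvg_partial_sum_norm_bounded (in_e _ hle).
set r := e / 2 / 2.
have r0 : 0 < r by rewrite divr_gt0.
have r_e : r + r = e / 2 by rewrite /r -splitr.
exists r, (M / r ^+ 2); split => //.
  rewrite divr_ge0 ?exprn_ge0 ?(ltW r0)//.
  by have := cM fset0; rewrite big_seq_fset0.
move=> u ux; pose B := [set v | `|v - x| <= r].
pose p A v := partial_sum (fun k => c k * \prod_i (v - x) 0 i ^+ k i) A.
apply: (taylor_le_lim (B := B) ux r0 (F := totally) (p := p)) => [A|v Bv]; last first.
  by apply: in_e; apply: le_trans Bv _; rewrite -r_e lerDr ltW.
apply: taylor_leW (cM A) _; rewrite /p.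
under eq_fun do rewrite partial_sum_seq.
apply: taylor_le_sum => // k; rewrite normrM.
apply: (taylor_leM _ _ (taylor_le_cst _ _ _ _)) => //.
rewrite normr_prod; apply: taylor_le_prod => // i.
rewrite normrX (_ : `|_| = r + r); last first.
  by rewrite r_e addrAC subrr add0r mxE gtr0_norm.
apply: taylor_leX => //; exact: taylor_le_coord.
Qed.

(** The quadratic remainder, divided by h, is O(h). The filter F stands for both the
    punctured neighbourhoods and the right neighbourhoods of 0, since flows are
    only differentiable from the right at time 0. *)
Lemma quad_error_chain f D C u r (F : set_system R) {FF : ProperFilter F}
    (g : R -> 'rV[R]_n) w : 0 < r ->
  (forall v, `|v - u| < r -> quad_error f D C u v) ->
  h @[h --> F] --> (0 : R) -> (\forall h \near F, h != 0) ->
  h^-1 *: (g h - u) @[h --> F] --> w ->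
  h^-1 * (f (g h) - f u) @[h --> F] --> dot D w.
Proof.
move=> r0 fD h0 hn0 gw.
pose q h := h^-1 *: (g h - u).
have gu : g h - u @[h --> F] --> (0 : 'rV[R]_n).
  rewrite -[X in _ --> X](scale0r w).
  apply: cvg_trans (cvgZ h0 gw); apply: near_eq_cvg.
  by near=> h; rewrite scalerA divff ?scale1r//; near: h.
have Dq : dot D (q h) @[h --> F] --> dot D w.
  by apply: cvg_dot => //; exact: cvg_cst.
have bd : C * `|h| * `|q h| ^+ 2 @[h --> F] --> (0 : R).
  rewrite -[X in _ --> X](_ : C * `|0 : R| * `|w| ^+ 2 = _); last first.
    by rewrite normr0 mulr0 mul0r.
  apply: cvgM; first by apply: cvgMr; exact: cvg_norm.
  by rewrite expr2; apply: cvgM; exact: cvg_norm.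
have rem : h^-1 * (f (g h) - f u) - dot D (q h) @[h --> F] --> (0 : R).
  apply/norm_cvg0P; apply: squeeze_cvgr bd; last exact: cvg_cst.
  near=> h; rewrite normr_ge0 /=.
  have hh : h != 0 by near: h.
  have /fD : `|g h - u| < r.
    by near: h; move/cvgr0Pnorm_lt : gu; apply.
  rewrite /quad_error => fg.
  rewrite /q dotZr -mulrBr normrM normrZ normfV exprMn.
  rewrite [leRHS](_ : _ = `|h|^-1 * (C * `|g h - u| ^+ 2)).
    by rewrite ler_pM2l ?invr_gt0 ?normr_gt0.
  by field; rewrite normr_eq0.
rewrite -[X in _ --> X]add0r; apply: cvg_trans (cvgD rem Dq).
by apply: near_eq_cvg; near=> h; rewrite /= subrK.
Unshelve. all: by end_near. Qed.

Lemma is_derive_cvg (V W : normedModType R) (g : V -> W) (a v : V) (l : W) :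
  h^-1 *: (g (h *: v + a) - g a) @[h --> 0^'] --> l -> is_derive a v g l.
Proof.
move=> gl; have dg : derivable g a v by apply: cvgP gl.
by split => //; apply: cvg_lim gl.
Qed.

Lemma quad_error_grad f D C u r : 0 < r ->
  (forall v, `|v - u| < r -> quad_error f D C u v) -> grad f u = D.
Proof.
move=> r0 fD; apply/rowP => i; rewrite mxE.
suff [] : is_derive u (delta_mx 0 i : 'rV[R]_n) f (D 0 i) by [].
apply: is_derive_cvg; rewrite -dot_delta.
apply: (quad_error_chain r0 fD).
- exact: nbhs_dnbhs.
- exact: nbhs_dnbhs_neq.
apply: cvg_near_cst.
by near=> h; rewrite addrK scalerA mulVf ?scale1r//; near: h; exact: nbhs_dnbhs_neq.
Unshelve. all: by end_near. Qed.

Lemma analytic_quad_error_grad X f x : real_analytic_on X f -> X x ->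
  exists r C : R, [/\ 0 < r, 0 <= C & forall u v, `|u - x| < r -> `|v - x| < r ->
    quad_error f (grad f u) C u v].
Proof.
move=> fa Xx; have [r [C [r0 C0 fD]]] := analytic_quad_error fa Xx.
exists r, C; split=> // u v ux vx; have [D uD] := fD u (ltW ux).
suff -> : grad f u = D by apply/uD/ltW.
apply: (@quad_error_grad _ _ C _ (r - `|u - x|)); first by rewrite subr_gt0.
move=> w wu; apply/uD/ltW; rewrite -(subrKA u).
by apply: le_lt_trans (ler_normD _ _) _; rewrite -ltrBrDr.
Qed.

(** Comparing the expansions of f between three points u, v, z gives
    <grad f v - grad f u, z - v> up to quadratic errors. With z - v a coordinate
    vector of length |v - u|, the three errors add up to at most
    (1 + 4 + 1) C |v - u|^2. The radius is divided by 3 to keep z in the ball. *)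
Lemma quad_error_lipschitz f C x r : 0 < r -> 0 <= C ->
  (forall u v, `|u - x| < r -> `|v - x| < r -> quad_error f (grad f u) C u v) ->
  forall u v, `|u - x| < r / 3 -> `|v - x| < r / 3 ->
    `|grad f v - grad f u| <= 6 * C * `|v - u|.
Proof.
move=> r0 C0 fD u v ux vx.
have [->|uv] := eqVneq v u; first by rewrite !subrr !normr0 mulr0.
set d := `|v - u|; have d0 : 0 < d by rewrite normr_gt0 subr_eq0.
have d2 : d < r / 3 + r / 3.
  by rewrite /d -(subrKA x) (le_lt_trans (ler_normD _ _))// ltrD// distrC.
apply: norm_le_coord => [|i]; first by rewrite !mulr_ge0// ltW.
pose z := v + d *: (delta_mx 0 i : 'rV[R]_n).
have zv : `|z - v| <= d.
  rewrite /z addrAC subrr add0r; apply: norm_le_coord => [|j]; first exact: ltW.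
  rewrite !mxE /=; case: (j == i); rewrite ?mulr1 ?mulr0 ?normr0 ?(ltW d0)//.
  by rewrite gtr0_norm.
have zx : `|z - x| < r.
  rewrite -(subrKA v); apply: le_lt_trans (ler_normD _ _) _.
  apply: (@le_lt_trans _ _ (d + `|v - x|)); first by rewrite lerD2r.
  by apply: (@lt_le_trans _ _ (r / 3 + r / 3 + r / 3)); [exact: ltrD|lra].
have [ux' vx'] : `|u - x| < r /\ `|v - x| < r by split; lra.
have zu : `|z - u| <= 2 * d.
  rewrite -(subrKA v); apply: le_trans (ler_normD _ _) _.
  by rewrite mulr_natl mulr2n lerD.
have := fD u z ux' zx; have := fD v z vx' zx; have := fD u v ux' vx'.
rewrite /quad_error -/d => euv evz euz.
have zv2 : `|z - v| ^+ 2 <= d ^+ 2 by rewrite lerXn2r ?nnegrE// ltW.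
have zu2 : `|z - u| ^+ 2 <= 4 * d ^+ 2.
  rewrite (_ : 4 * d ^+ 2 = (2 * d) ^+ 2); last by ring.
  by rewrite lerXn2r ?nnegrE// mulr_ge0// ltW.
have {evz} evz := le_trans evz (ler_wpM2l C0 zv2).
have {euz} euz := le_trans euz (ler_wpM2l C0 zu2).
have e : (grad f v - grad f u) 0 i * d =
    (f z - f u - dot (grad f u) (z - u)) - (f z - f v - dot (grad f v) (z - v))
    - (f v - f u - dot (grad f u) (v - u)).
  have -> : z - u = (z - v) + (v - u) by rewrite subrKA.
  have -> : z - v = d *: delta_mx 0 i by rewrite /z addrAC subrr add0r.
  by rewrite dotDr !dotZr !dot_delta !mxE; ring.
rewrite -(ler_pM2r d0) -[in leLHS](gtr0_norm d0) -normrM e.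
apply: le_trans (ler_normB _ _) _.
have := ler_normB (f z - f u - dot (grad f u) (z - u))
  (f z - f v - dot (grad f v) (z - v)).
lra.
Qed.

(** A single d serves as Lebesgue number and, through its inverse, as the constant
    of both estimates: shrinking d weakens both requirements, so the local
    constants on a compact set can be made uniform by a covering argument. *)
Lemma compact_uniform_quad_error X K f : open X -> compact K -> K `<=` X ->
  real_analytic_on X f ->
  exists2 d : R, 0 < d & forall u v, K u -> `|v - u| < d ->
    [/\ X v, quad_error f (grad f u) d^-1 u v
      & `|grad f v - grad f u| <= d^-1 * `|v - u|].
Proof.
move=> oX cK KX fa.
pose P (d : R) u := forall v, `|v - u| < d ->
    [/\ X v, quad_error f (grad f u) d^-1 u v
      & `|grad f v - grad f u| <= d^-1 * `|v - u|].
have /compact_near_coveringP cov := cK.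
have : \forall d \near 0^'+, K `<=` P d.
  apply: cov => x Kx; have Xx := KX _ Kx.
  have [r [C [r0 C0 fD]]] := analytic_quad_error_grad fa Xx.
  have gL := quad_error_lipschitz r0 C0 fD.
  have /nbhs_ballP[e /= e0 eX] := oX _ Xx.
  pose d1 := Num.min (r / 6) (e / 2).
  have d10 : 0 < d1 by rewrite lt_min !divr_gt0.
  have C1 : 0 < 6 * C + 1 by rewrite ltr_wpDl// mulr_ge0.
  near=> u d => v vu.
  have ux : `|u - x| < d1.
    near: u; apply/nbhs_ballP; exists d1 => //= u.
    by rewrite -ball_normE /ball_ /= distrC.
  have dd1 : d < d1 by near: d; exact: nbhs_right_lt.
  have d0 : 0 < d by near: d; exact: nbhs_right_gt.
  have dC : 6 * C <= d^-1.
    apply: (@le_trans _ _ (6 * C + 1)); first by rewrite lerDl.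
    rewrite -[leLHS]invrK lef_pV2 ?posrE ?invr_gt0// ltW//.
    by near: d; apply: nbhs_right_lt; rewrite invr_gt0.
  have vx : `|v - x| < 2 * d1.
    rewrite -(subrKA u); apply: le_lt_trans (ler_normD _ _) _.
    by rewrite mulr_natl mulr2n ltrD// (lt_trans vu).
  move: vx ux; rewrite /d1 => vx ux.
  have [ur ue] : `|u - x| < r / 6 /\ `|u - x| < e / 2.
    by move: ux; rewrite lt_min => /andP.
  have [vr ve] : `|v - x| < r / 3 /\ `|v - x| < e.
    split.
      apply: lt_le_trans vx _; rewrite (_ : r / 3 = 2 * (r / 6)); last by field.
      by rewrite ler_wpM2l// ge_min lexx.
    apply: lt_le_trans vx _; rewrite [leRHS](_ : e = 2 * (e / 2)); last by field.
    by rewrite ler_wpM2l// ge_min lexx orbT.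
  split.
  - by apply: eX; rewrite -ball_normE /ball_ /= distrC.
  - apply: le_trans (fD u v _ _) _; [lra|lra|].
    apply: ler_wpM2r; [exact: exprn_ge0|lra].
  - by apply: le_trans (gL u v _ _) _; [lra|lra|apply: ler_wpM2r].
move=> Pd; have : \forall d \near (0 : R)^'+, 0 < d /\ K `<=` P d.
  by apply: filterI => //; exact: nbhs_right_gt.
by move=> /filter_ex[d [d0 KP]]; exists d => // u v /KP; apply.
Unshelve. all: by end_near. Qed.

End quad.

(** * Solutions as limits of Euler polygons *)

Section euler.
Context {R : realType} {V : normedModType R}.
Variables (K : set V) (F : V -> V) (x0 : V) (L B h0 : R).
Hypotheses (L0 : 0 <= L) (B0 : 0 <= B) (h00 : 0 < h0).
Hypotheses (Kx0 : K x0) (cK : compact K).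
Hypothesis F_lip : forall x y, K x -> K y -> `|F y - F x| <= L * `|y - x|.
Hypothesis F_bound : forall x, K x -> `|F x| <= B.
Hypothesis F_step : forall x (h : R), K x -> 0 < h < h0 -> K (x + h *: F x).

Definition euler (h : R) (j : nat) : V := iter j (fun x => x + h *: F x) x0.

Lemma euler_in (h : R) j : 0 < h < h0 -> K (euler h j).
Proof. by move=> hh; elim: j => [//|j IH] /=; exact: F_step. Qed.

Lemma euler_dist (h : R) j i : 0 < h < h0 ->
  `|euler h (j + i) - euler h j| <= i%:R * h * B.
Proof.
move=> hh; have /andP[hp _] := hh; elim: i => [|i IH].
  by rewrite addn0 subrr normr0 !mul0r.
rewrite addnS /= -/(euler h (j + i)) addrAC.
apply: le_trans (ler_normD _ _) _; rewrite -addn1 natrD !mulrDl lerD// mul1r.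
by rewrite normrZ gtr0_norm// ler_wpM2l ?(ltW hp)//; apply/F_bound/euler_in.
Qed.

(** The velocity at step j + i differs from the velocity at step j by at most
    L B i h; summing over i gives the quadratic bound. *)
Lemma euler_error (h : R) j i : 0 < h < h0 ->
  `|euler h (j + i) - euler h j - (i%:R * h) *: F (euler h j)| <=
  L * B * (i%:R * h) ^+ 2.
Proof.
move=> hh; have /andP[hp _] := hh; elim: i => [|i IH].
  by rewrite addn0 subrr !mul0r scale0r subr0 normr0 expr0n /= mulr0.
set z := euler h j in IH *; set zi := euler h (j + i) in IH *.
have -> : euler h (j + i.+1) - z - (i.+1%:R * h) *: F z =
    (zi - z - (i%:R * h) *: F z) + h *: (F zi - F z).
  rewrite addnS /= -/(euler h (j + i)) -/zi -addn1 natrD mulrDl mul1r scalerDl.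
  by rewrite scalerBr opprD [RHS]addrACA [zi - z + _]addrAC.
apply: le_trans (ler_normD _ _) _.
have Fz : `|h *: (F zi - F z)| <= h * (L * (i%:R * h * B)).
  rewrite normrZ gtr0_norm// ler_wpM2l ?(ltW hp)//.
  apply: le_trans (F_lip _ _) _; try exact: euler_in.
  by rewrite ler_wpM2l//; exact: euler_dist.
apply: le_trans (lerD IH Fz) _.
rewrite -subr_ge0 -addn1 natrD (_ : _ - _ = L * B * h ^+ 2 * (i%:R + 1)); last by ring.
by rewrite !mulr_ge0 ?exprn_ge0 ?addr_ge0 ?(ltW hp).
Qed.

(** A step function of t rather than a piecewise affine one: it takes its values
    among the vertices, hence in K. *)
Definition euler_at (k : nat) (t : R) : V :=
  euler k.+1%:R^-1 (Num.truncn (t * k.+1%:R)).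

Lemma euler_at_error k (t h : R) : k.+1%:R^-1 < h0 -> 0 <= t -> 0 <= h ->
  `|euler_at k (t + h) - euler_at k t - h *: F (euler_at k t)| <=
  L * B * (h + k.+1%:R^-1) ^+ 2 + k.+1%:R^-1 * B.
Proof.
move=> kh t0 hge0; rewrite /euler_at; set N : R := k.+1%:R.
have N0 : 0 < N by rewrite ltr0n.
have Nh : 0 < N^-1 < h0 by rewrite invr_gt0 N0.
set j := Num.truncn (t * N); set j' := Num.truncn ((t + h) * N).
have jj' : (j <= j')%N.
  by apply: le_truncn; rewrite ler_wpM2r ?(ltW N0)// lerDl.
have /andP[jl ju] : j%:R <= t * N < j.+1%:R.
  by apply: truncn_itv; rewrite mulr_ge0// ltW.
have /andP[jl' ju'] : j'%:R <= (t + h) * N < j'.+1%:R.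
  by apply: truncn_itv; rewrite mulr_ge0 ?addr_ge0// ltW.
set i := (j' - j)%N; have ji : (j + i)%N = j' by rewrite /i subnKC.
have iN : `|i%:R * N^-1 - h| <= N^-1.
  rewrite -[leRHS]mul1r -[X in _ - X](mulfK (lt0r_neq0 N0)) -mulrBl.
  rewrite normrM [X in _ * X]gtr0_norm ?invr_gt0// ler_wpM2r ?invr_ge0 ?(ltW N0)//.
  rewrite /i natrB// ler_norml.
  move: jl ju jl' ju'; rewrite -!natr1 mulrDl => *; apply/andP; split; lra.
have i0 : 0 <= i%:R * N^-1 by rewrite mulr_ge0// invr_ge0 ltW.
rewrite -ji; set z := euler _ j.
rewrite (_ : _ - _ = (euler N^-1 (j + i) - z - (i%:R * N^-1) *: F z) +
    (i%:R * N^-1 - h) *: F z); last by rewrite scalerBl addrA subrK.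
apply: le_trans (ler_normD _ _) _; apply: lerD.
  apply: le_trans (euler_error _ _ Nh) _.
  rewrite ler_wpM2l ?mulr_ge0// lerXn2r ?nnegrE ?addr_ge0 ?invr_ge0 ?(ltW N0)//.
  by move: iN; rewrite ler_norml => /andP[_]; rewrite lerBlDl.
by rewrite normrZ; apply: ler_pM => //; apply/F_bound/euler_in.
Qed.

(** Pointwise limits suffice: the estimate of [euler_at_error] involves the values
    at t and t + h alone, and it loses its step-dependent terms in the limit. *)
Lemma euler_limit : exists phi : R -> V,
  [/\ phi 0 = x0, forall t : R, 0 <= t -> K (phi t) &
      forall t h : R, 0 <= t -> 0 <= h ->
        `|phi (t + h) - phi t - h *: F (phi t)| <= L * B * h ^+ 2].
Proof.
have [U [UU oU]] := @ultraFilterLemma nat \oo _.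
have inv0 : (k.+1%:R^-1 : R) @[k --> U] --> 0.
  by move=> A /cvg_harmonic /oU.
have Uh : \forall k \near U, k.+1%:R^-1 < h0.
  by apply: oU; exact: (cvgr_lt _ (@cvg_harmonic R)).
have lim t : exists l, 0 <= t -> K l /\ euler_at k t @[k --> U] --> l.
  have [t0|] := leP 0 t; last by exists x0.
  have [|l Kl yl] := compact_ultra_cvg (h := euler_at ^~ t) UU cK; last by exists l.
  near=> k; apply: euler_in; rewrite invr_gt0 ltr0n /=; near: k; exact: Uh.
have {lim} [phi phiP] := choice lim.
have phiK t : 0 <= t -> K (phi t) by move=> /phiP[].
have phil t : 0 <= t -> euler_at k t @[k --> U] --> phi t by move=> /phiP[].
exists phi; split => //.
  have y0 : euler_at k 0 @[k --> U] --> x0.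
    apply: cvg_near_cst; apply: filterE => k.
    by rewrite /euler_at mul0r truncn0.
  exact: (cvg_unique (@norm_hausdorff R V) (phil 0 (lexx _)) y0).
move=> t h t0 hge0.
have Fl : F (euler_at k t) @[k --> U] --> F (phi t).
  apply/cvgrPdistC_lt => e e0 /=; near=> k.
  have yK : K (euler_at k t).
    by apply: euler_in; rewrite invr_gt0 ltr0n /=; near: k; exact: Uh.
  apply: le_lt_trans (F_lip (phiK _ t0) yK) _.
  have L1 : 0 < L + 1 by rewrite ltr_wpDl.
  apply: (@le_lt_trans _ _ ((L + 1) * `|euler_at k t - phi t|)).
    by rewrite ler_wpM2r// lerDl.
  rewrite mulrC -ltr_pdivlMr//; near: k.
  by apply: (cvgr_distC_lt _ _ (phil t t0)); rewrite divr_gt0// ltr_wpDl.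
have lhs : `|euler_at k (t + h) - euler_at k t - h *: F (euler_at k t)|
    @[k --> U] --> `|phi (t + h) - phi t - h *: F (phi t)|.
  apply: cvg_norm; apply: cvgB; last exact: cvgZr.
  by apply: cvgB; apply: phil => //; exact: addr_ge0.
have rhs : L * B * (h + k.+1%:R^-1) ^+ 2 + k.+1%:R^-1 * B
    @[k --> U] --> L * B * h ^+ 2.
  rewrite -[X in _ --> X]addr0 -[X in _ --> _ + X](mul0r B) -{2}[h]addr0.
  apply: cvgD; last exact: cvgMl.
  by apply: cvgMr; rewrite !expr2; apply: cvgM; apply: cvgD => //; exact: cvg_cst.
apply: (ler_cvg_to lhs rhs); near=> k; apply: euler_at_error => //.
by near: k; exact: Uh.
Unshelve. all: by end_near. Qed.

End euler.

Section derivative_from_quadratic_error.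
Context {R : realType} {V : normedModType R}.

Lemma quadratic_error_cvg (F : set_system R) {FF : ProperFilter F}
    (g : R -> V) (w : V) (C : R) :
  h @[h --> F] --> (0 : R) -> (\forall h \near F, h != 0) ->
  (\forall h \near F, `|g h - h *: w| <= C * h ^+ 2) ->
  h^-1 *: g h @[h --> F] --> w.
Proof.
move=> h0 hn0 gw.
have bd : C * `|h| @[h --> F] --> (0 : R).
  rewrite -[X in _ --> X](mulr0 C) -(@normr0 _ R).
  by apply: cvgMr; exact: cvg_norm.
apply/subr_cvg0/norm_cvg0P; apply: squeeze_cvgr bd; last exact: cvg_cst.
near=> h; rewrite normr_ge0 /=.
have hh : h != 0 by near: h.
have nh : 0 < `|h| by rewrite normr_gt0.
rewrite -[w in X in X <= _](scale1r w) -(mulVf hh) -scalerA -scalerBr normrZ normfV.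
rewrite ler_pdivrMl//; apply: (@le_trans _ _ (C * h ^+ 2)); first by near: h.
by rewrite -(real_normK (num_real h)) expr2 mulrCA.
Unshelve. all: by end_near. Qed.

End derivative_from_quadratic_error.

(** * The gradient flow *)

Section flow.
Context {R : realType} {n : nat}.
Implicit Types (X : set 'rV[R]_n) (f : 'rV[R]_n -> R) (u v x : 'rV[R]_n).

Lemma enorm_sqr v : enorm v ^+ 2 = dot v v.
Proof.
rewrite sqr_sqrtr; last by apply: sumr_ge0 => i _; exact: sqr_ge0.
by apply: eq_bigr => i _; rewrite expr2.
Qed.

Lemma norm_le_enorm v : `|v| <= enorm v.
Proof.
apply: norm_le_coord => [|i]; first exact: sqrtr_ge0.
rewrite -sqrtr_sqr ler_wsqrtr// (bigD1 i)//= lerDl.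
by apply: sumr_ge0 => j _; exact: sqr_ge0.
Qed.

(** The expansion is only assumed forward in time. For h < 0 it is applied from
    t + h, and the velocity there is compared with the velocity at t. *)
Lemma quadratic_error_is_derive (V : normedModType R) (phi F : R -> V)
    (L B C t : R) : 0 <= L -> 0 <= C -> 0 < t ->
  (forall s, 0 <= s -> `|F s| <= B) ->
  (forall s s', 0 <= s -> 0 <= s' -> `|F s' - F s| <= L * `|phi s' - phi s|) ->
  (forall s h, 0 <= s -> 0 <= h ->
     `|phi (s + h) - phi s - h *: F s| <= C * h ^+ 2) ->
  is_derive t 1 phi (F t).
Proof.
move=> L0 C0 t0 FB FL err; apply: is_derive_cvg.
apply: (@quadratic_error_cvg _ _ _ _ _ _ (C + L * (B + C * t))).
- exact: nbhs_dnbhs.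
- exact: nbhs_dnbhs_neq.
near=> h; rewrite [h *: 1]mulr1 [h + t]addrC.
have ht : `|h| < t.
  by near: h; exact: dnbhs0_lt.
have B0 : 0 <= B by apply: le_trans (FB 0 (lexx _)).
have LBC : 0 <= L * (B + C * t).
  by rewrite mulr_ge0// addr_ge0// mulr_ge0// ltW.
have [h0|h0] := leP 0 h.
  apply: le_trans (err _ _ (ltW t0) h0) _.
  by rewrite ler_wpM2r ?sqr_ge0// lerDl.
have s0 : 0 <= t + h by move: ht; rewrite ltr_norml => /andP[? ?]; lra.
have nh0 : 0 <= - h by rewrite oppr_ge0 ltW.
have := err _ _ s0 nh0; rewrite addrK sqrrN.
set s := t + h in s0 *; set E := _ - _ - _ => Eh.
have dphi : `|phi t - phi s| <= - h * (B + C * t).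
  rewrite (_ : phi t - phi s = E + (- h) *: F s); last by rewrite subrK.
  apply: le_trans (ler_normD _ _) _; rewrite normrZ (ger0_norm nh0).
  apply: (@le_trans _ _ (C * h ^+ 2 + - h * B)).
    by apply: lerD => //; rewrite ler_wpM2l// FB.
  rewrite mulrDr addrC lerD2l -sqrrN expr2 mulrCA ler_wpM2l// ler_wpM2l//.
  by move: ht; rewrite ltr0_norm// => /ltW.
rewrite (_ : phi s - phi t - h *: F t = - E + h *: (F s - F t)); last first.
  by rewrite /E scaleNr opprK opprD opprB scalerBr addrA subrK.
apply: le_trans (ler_normD _ _) _; rewrite normrN mulrDl lerD//.
rewrite normrZ (ltr0_norm h0) -sqrrN expr2 mulrCA ler_wpM2l//.
rewrite distrC; apply: le_trans (FL _ _ s0 (ltW t0)) _.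
by rewrite -mulrA ler_wpM2l// mulrC.
Unshelve. all: by end_near. Qed.

(** K is the sublevel set of f(x0). A step h <= d of gradient descent changes f by at
    most - h |g|^2 + d^-1 h^2 |g|^2 <= 0 and moves by less than d, hence does not
    leave K. *)
Lemma gradient_flow_from X f x0 : open X -> real_analytic_on X f ->
  proper_on X f -> bounded_gradient X f -> X x0 ->
  exists phi : R -> 'rV[R]_n, [/\ phi 0 = x0, forall t : R, 0 <= t -> X (phi t),
    h^-1 *: (phi h - phi 0) @[h --> 0^'+] --> - grad f (phi 0) &
    forall t : R, 0 < t -> is_derive t 1 phi (- grad f (phi t))].
Proof.
move=> oX fa fp [B gB] Xx0.
pose K := [set x | X x /\ f x <= f x0].
have cK : compact K := fp (f x0).
have Kx0 : K x0 by split.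
have KX : K `<=` X by move=> x [].
have [d d0 dK] := compact_uniform_quad_error oX cK KX fa.
pose F x := - grad f x.
have FB x : K x -> `|F x| <= B.
  by move=> /KX Xx; rewrite normrN; apply: le_trans (norm_le_enorm _) (gB _ Xx).
have B0 : 0 <= B by apply: le_trans (FB _ Kx0).
(* d^-1 for points closer than d, and d^-1 * (2 * B) for the others, where the
   difference of the values is at most 2 * B *)
pose L := d^-1 * (1 + 2 * B).
have L0 : 0 <= L by rewrite mulr_ge0 ?invr_ge0 ?(ltW d0)// addr_ge0// mulr_ge0.
have FL x y : K x -> K y -> `|F y - F x| <= L * `|y - x|.
  move=> Kx Ky; rewrite /L mulrDr mulrDl; have [yx|yx] := ltP `|y - x| d.
    have [_ _ gl] := dK x y Kx yx.
    rewrite -opprD normrN mulr1; apply: le_trans gl _.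
    by rewrite lerDl !mulr_ge0 ?invr_ge0 ?(ltW d0).
  apply: (@le_trans _ _ (2 * B)).
    apply: le_trans (ler_normB _ _) _.
    by rewrite mulr_natl mulr2n lerD// FB.
  apply: (@le_trans _ _ (d^-1 * (2 * B) * `|y - x|)); last first.
    by rewrite lerDr mulr_ge0// mulr_ge0 ?invr_ge0 ?(ltW d0).
  rewrite [leRHS](_ : _ = `|y - x| / d * (2 * B)); last by ring.
  by rewrite ler_peMl ?mulr_ge0// ler_pdivlMr// mul1r.
(* h <= d for the descent, h * (B + 1) < d for the length of the step *)
pose h0 := Num.min d (d / (B + 1)).
have B1 : 0 < B + 1 by rewrite ltr_wpDl.
have h00 : 0 < h0 by rewrite lt_min d0 divr_gt0.
have Fstep x (h : R) : K x -> 0 < h < h0 -> K (x + h *: F x).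
  move=> Kx /andP[hp]; rewrite lt_min => /andP[hd hdB].
  have xh : (x + h *: F x) - x = - (h *: grad f x).
    by rewrite addrAC subrr add0r scalerN.
  have near_x : `|(x + h *: F x) - x| < d.
    rewrite xh normrN normrZ gtr0_norm//.
    apply: (@le_lt_trans _ _ (h * (B + 1))).
      rewrite ler_wpM2l ?(ltW hp)//; apply: (@le_trans _ _ B); last by rewrite lerDl.
      by rewrite -normrN FB.
    by rewrite -ltr_pdivlMr.
  have [Xh qh _] := dK _ _ Kx near_x; split => //.
  apply: le_trans (proj2 Kx).
  move: qh; rewrite /quad_error xh dotNr dotZr opprK normrN normrZ gtr0_norm//.
  set g := grad f x.
  rewrite exprMn => /(le_trans (ler_norm _)) fh.
  have g2 : `|g| ^+ 2 <= dot g g.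
    by rewrite -enorm_sqr lerXn2r ?nnegrE ?sqrtr_ge0// norm_le_enorm.
  have hg : d^-1 * (h ^+ 2 * `|g| ^+ 2) <= h * dot g g.
    rewrite [leLHS](_ : _ = h * (h / d * `|g| ^+ 2)); last by ring.
    rewrite ler_wpM2l ?(ltW hp)//; apply: le_trans g2.
    by rewrite ler_piMl ?exprn_ge0// ler_pdivrMr// mul1r ltW.
  lra.
have [phi [phi0 phiK err]] := euler_limit L0 B0 h00 Kx0 cK FL FB Fstep.
exists phi; split => // [t t0||t t0].
- exact/KX/phiK.
- apply: (@quadratic_error_cvg _ _ _ _ (fun h => phi h - phi 0) _ (L * B)).
  + exact: cvg_at_right_filter.
  + by near=> h; rewrite gt_eqF//; near: h; exact: nbhs_right_gt.
  near=> h; have := err 0 h (lexx _); rewrite add0r; apply; apply: ltW.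
  by near: h; exact: nbhs_right_gt.
apply: (@quadratic_error_is_derive _ _ (F \o phi) L B (L * B)) => //.
- exact: mulr_ge0.
- by move=> s s0; exact/FB/phiK.
- by move=> s s' s0 s'0; apply: FL; exact: phiK.
Unshelve. all: by end_near. Qed.

Lemma gradient_flow_exists X f : open X -> real_analytic_on X f ->
  proper_on X f -> bounded_gradient X f -> exists phi, gradient_flow X f phi.
Proof.
move=> oX fa fp gb.
have /choice[phi phiP] x0 : exists phi : R -> 'rV[R]_n, X x0 ->
    [/\ phi 0 = x0, forall t : R, 0 <= t -> X (phi t),
    h^-1 *: (phi h - phi 0) @[h --> 0^'+] --> - grad f (phi 0) &
    forall t : R, 0 < t -> is_derive t 1 phi (- grad f (phi t))].
  have [Xx0|nX] := pselect (X x0); last by exists (fun=> x0).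
  by have [phi ?] := gradient_flow_from oX fa fp gb Xx0; exists phi.
by exists (fun t x0 => phi x0 t) => x0 /phiP.
Qed.

Lemma analytic_chain X f x (F : set_system R) {FF : ProperFilter F}
    (g : R -> 'rV[R]_n) w : real_analytic_on X f -> X x ->
  h @[h --> F] --> (0 : R) -> (\forall h \near F, h != 0) ->
  h^-1 *: (g h - x) @[h --> F] --> w ->
  h^-1 * (f (g h) - f x) @[h --> F] --> dot (grad f x) w.
Proof.
move=> fa Xx; have [r [C [r0 _ fD]]] := analytic_quad_error_grad fa Xx.
apply: (quad_error_chain r0) => v; apply: fD.
by rewrite subrr normr0.
Qed.

Lemma gradient_flow_decay X f phi x0 : real_analytic_on X f ->
  gradient_flow X f phi -> X x0 -> forall t : R, 0 < t ->
  is_derive t 1 (fun s => f (phi s x0)) (- enorm (grad f (phi t x0)) ^+ 2).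
Proof.
move=> fa fl Xx0 t t0; have [_ phiX _ /(_ t t0) phid] := fl _ Xx0.
rewrite enorm_sqr -dotNr; apply: is_derive_cvg.
apply: (analytic_chain fa (phiX _ (ltW t0))).
- exact: nbhs_dnbhs.
- exact: nbhs_dnbhs_neq.
by case: phid => dphi <-; exact: dphi.
Qed.

Lemma gradient_flow_right_continuous X f phi x0 : real_analytic_on X f ->
  gradient_flow X f phi -> X x0 ->
  f (phi s x0) @[s --> 0^'+] --> f (phi (0 : R) x0).
Proof.
move=> fa fl Xx0; have [_ phiX phir _] := fl _ Xx0.
have h0 : h @[h --> (0 : R)^'+] --> (0 : R) by exact: cvg_at_right_filter.
have hn0 : \forall h \near (0 : R)^'+, h != 0.
  by near=> h; rewrite gt_eqF//; near: h; exact: nbhs_right_gt.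
have fc := analytic_chain (FF := at_right_proper_filter (0 : R)) fa
  (phiX _ (lexx _)) h0 hn0 phir.
set D := dot _ _ in fc; apply/subr_cvg0; rewrite -[X in _ --> X](mul0r D).
apply: cvg_trans (cvgM h0 fc); apply: near_eq_cvg.
by near=> h; rewrite /= [LHS]mulrA divff ?mul1r//; near: h.
Unshelve. all: by end_near. Qed.

Lemma gradient_flow_continuous X f phi x0 (b : R) : real_analytic_on X f ->
  gradient_flow X f phi -> X x0 -> 0 < b ->
  {within `[0, b], continuous (fun s => f (phi s x0))}.
Proof.
move=> fa fl Xx0 b0; apply/(continuous_within_itvP _ b0).
have dc (t : R) : 0 < t -> {for t, continuous (fun s => f (phi s x0))}.
  move=> t0; have [d _] := gradient_flow_decay fa fl Xx0 t0.
  exact/differentiable_continuous/derivable1_diffP.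
split.
- by move=> t; rewrite in_itv /= => /andP[t0 _]; exact: dc.
- exact: gradient_flow_right_continuous fa fl Xx0.
- exact/cvg_at_left_filter/dc.
Qed.

(** * Decay along the flow *)

Lemma KSAT_decay X f (a b : R) x : 0 < a -> 0 < b -> has_lbound (f @` X) -> X x ->
  alpha_sat a b (f x - finf X f) <= enorm (grad f x) ->
  0 <= f x - finf X f /\
  a * (f x - finf X f) / (b + (f x - finf X f)) <= enorm (grad f x) ^+ 2.
Proof.
move=> a0 b0 lb Xx; set r := f x - _ => ar.
have r0 : 0 <= r by rewrite subr_ge0; apply: ge_inf => //; exists x.
split=> //; have q0 : 0 <= a * r / (b + r).
  by rewrite divr_ge0 ?(addr_ge0 (ltW b0) r0)// mulr_ge0// ltW.
by rewrite -[leLHS]sqr_sqrtr// lerXn2r ?nnegrE ?sqrtr_ge0.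
Qed.

(** Gronwall's inequality: the product of V with expR (mu * (t - T)) does not
    increase. *)
Lemma le_expR_decay (V dV : R -> R) (T mu : R) :
  (forall t : R, T <= t -> is_derive t 1 V (dV t)) ->
  (forall t : R, T <= t -> dV t <= - (mu * V t)) ->
  forall t : R, T < t -> V t <= V T * expR (- mu * (t - T)).
Proof.
move=> VdV dV_le t Tt; pose W s := V s * expR (mu * (s - T)).
have dW (s : R) : T <= s ->
    is_derive s 1 W (expR (mu * (s - T)) * (dV s + mu * V s)).
  move=> Ts; have dVs := VdV s Ts.
  have dl : is_derive s 1 (fun r => mu * (r - T)) mu.
    have d1 : is_derive s 1 (fun r => r - T) (1 - 0) by exact: is_deriveB.
    by have := is_deriveZ mu d1; rewrite subr0 [mu *: 1]mulr1.
  apply: is_derive_eq (is_deriveM dVs (is_derive1_comp (is_derive_expR _) dl)) _.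
  by rewrite /GRing.scale /=; ring.
have WT : W t <= W T.
  have cW : {within `[T, t], continuous W}.
    apply: derivable_within_continuous => r.
    by rewrite in_itv /= => /andP[/dW[]].
  have dWT r : r \in `]T, t[ ->
      is_derive r 1 W (expR (mu * (r - T)) * (dV r + mu * V r)).
    by rewrite in_itv /= => /andP[/ltW/dW].
  have [c] := MVT Tt dWT cW.
  rewrite in_itv /= => /andP[/ltW Tc _] W_c.
  rewrite -subr_le0 W_c; apply: mulr_le0_ge0; last by rewrite subr_ge0 ltW.
  apply: mulr_ge0_le0; first exact: expR_ge0.
  by have := dV_le c Tc; lra.
rewrite mulNr expRN -ler_pdivrMr ?invr_gt0 ?expR_gt0// invrK.
by move: WT; rewrite /W subrr mulr0 expR0 mulr1.
Qed.

Lemma gradient_flow_GLES_along X f phi : real_analytic_on X f ->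
  has_lbound (f @` X) -> bounded_gradient X f -> KSAT_lower_bound X f ->
  gradient_flow X f phi -> GLES_along X f phi.
Proof.
move=> fa f_lb [L gL] [a [b [a0 b0 ab]]] fl.
(* 1 is added because L may be 0 *)
exists (L ^+ 2 + 1) => [|x0 Xx0 T T0]; first by rewrite ltr_wpDl// sqr_ge0.
have [_ phiX _ _] := fl _ Xx0.
have fd := gradient_flow_decay fa fl Xx0.
pose V t := f (phi t x0) - finf X f.
have VP (t : R) : 0 <= t -> 0 <= V t /\
    a * V t / (b + V t) <= enorm (grad f (phi t x0)) ^+ 2.
  by move=> /phiX Xt; apply: KSAT_decay (ab _ Xt).
have dV (t : R) : 0 < t -> is_derive t 1 V (- enorm (grad f (phi t x0)) ^+ 2).
  by move=> /fd ?; rewrite -[X in is_derive _ _ _ X]subr0; exact: is_deriveB.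
have cV (s t : R) : 0 <= s -> 0 < t -> {within `[s, t], continuous V}.
  move=> s0 t0; have c0 : {within `[0, t], continuous V}.
    move=> r; apply: cvgB; last exact: cvg_cst.
    exact: (gradient_flow_continuous fa fl Xx0 t0).
  apply: continuous_subspaceW c0 => r /=.
  by rewrite !in_itv /= => /andP[sr ->]; rewrite (le_trans s0).
have mean (s t : R) : 0 <= s -> s <= t -> 0 < t -> exists2 c, s <= c <= t
    & V t - V s = - enorm (grad f (phi c x0)) ^+ 2 * (t - s).
  move=> s0 st t0.
  have dVst r : r \in `]s, t[ ->
      is_derive r 1 V (- enorm (grad f (phi r x0)) ^+ 2).
    by rewrite in_itv /= => /andP[sr _]; apply: dV; exact: le_lt_trans sr.
  have [c] := MVT_segment st dVst (cV s t s0 t0).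
  by rewrite in_itv; exists c.
have bV (t : R) : 0 <= t -> 0 < b + V t by move=> /VP[Vt _]; rewrite ltr_wpDr.
exists (a / (b + V T)); first by rewrite divr_gt0// bV// ltW.
move=> t t0; rewrite -/(V t) -/(V T); case: ifPn => [tT|].
  have [c /andP[tc _] Vc] := mean _ _ t0 tT T0.
  have gc : enorm (grad f (phi c x0)) ^+ 2 <= L ^+ 2.
    have gcL : enorm (grad f (phi c x0)) <= L.
      by apply/gL/phiX; exact: le_trans tc.
    by rewrite lerXn2r ?nnegrE ?sqrtr_ge0// (le_trans _ gcL)// sqrtr_ge0.
  have {gc} : enorm (grad f (phi c x0)) ^+ 2 * (T - t) <= L ^+ 2 * (T - t).
    by rewrite ler_wpM2r// subr_ge0.
  move: Vc; rewrite mulNr; lra.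
rewrite -ltNge => Tt.
have VT (s : R) : T <= s -> V s <= V T.
  move=> Ts; have [c _ Vc] := mean _ _ (ltW T0) Ts (lt_le_trans T0 Ts).
  by rewrite -subr_le0 Vc mulNr oppr_le0 mulr_ge0 ?sqr_ge0// subr_ge0.
apply: le_expR_decay Tt => s Ts; first exact/dV/(lt_le_trans T0).
have s0 : 0 <= s by apply: le_trans Ts; exact: ltW.
have [Vs0 gs] := VP s s0; rewrite lerN2; apply: le_trans gs.
rewrite mulrAC ler_wpM2l ?mulr_ge0 ?(ltW a0)//.
by rewrite lef_pV2 ?posrE ?bV// ?(ltW T0)// lerD2l VT.
Qed.

End flow.

Theorem lemma6 (R : realType) (n : nat) (X : set 'rV[R]_n) (f : 'rV[R]_n -> R)
  (X_open : open X) (X_nonempty : X !=set0)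
  (f_analytic : real_analytic_on X f)
  (f_bounded_below : has_lbound (f @` X))
  (f_proper : proper_on X f)
  (gradf_bounded : bounded_gradient X f)
  (f_KSAT : KSAT_lower_bound X f) :
  GLES X f.
Proof.
split; first exact: gradient_flow_exists.
by move=> phi; exact: gradient_flow_GLES_along.
Qed.
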